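(* Let $d\ge2$, let $A$ be a bi-Koszul algebra determined by $\varDelta_d$, and let $E=E(A)$ with an $A_\infty$-Ext-algebra structure $\{m_n\}$. Then the multiplications $m_i$ ($i=2,3,4,d,d+1$) vanish on all tensor products of the pieces $E^{[0]},E^{[1]},E^{[2]}_{(d)},E^{[2]}_{(d+1)}$ except possibly on the following ones (including all permutations of the factors; the lists are merged when some of the indices $2,3,4,d,d+1$ coincide), where they take values in the indicated piece: \begin{itemize} \item $m_2$: $E^{[0]}E^{[0]}\to E^{[0]}$; $E^{[0]}E^{[1]}\to E^{[1]}$ and $E^{[2]}_{(d)}E^{[2]}_{(d+1)}\to E^{[1]}$; $E^{[0]}E^{[2]}\to E^{[2]}$. \item $m_3$: $E^{[0]}E^{[2]}_{(d)}E^{[2]}_{(d)}\to E^{[0]}$; $E^{[1]}E^{[2]}_{(d)}E^{[2]}_{(d)}\to E^{[1]}$; $E^{[0]}E^{[1]}E^{[2]}_{(d)}\to E^{[2]}$ and $E^{[2]}E^{[2]}_{(d)}E^{[2]}_{(d)}\to E^{[2]}$. \item $m_4$: $E^{[2]}_{(d)}E^{[2]}_{(d)}E^{[2]}_{(d)}E^{[2]}_{(d)}\to E^{[0]}$; $E^{[1]}E^{[2]}_{(d)}E^{[2]}_{(d)}E^{[2]}_{(d)}\to E^{[2]}$. \item $m_d$: $\underbrace{E^{[1]}\cdots E^{[1]}}_{d-1}E^{[2]}_{(d+1)}\to E^{[0]}$; $\underbrace{E^{[1]}\cdots E^{[1]}}_{d}\to E^{[2]}$. \item $m_{d+1}$: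 $\underbrace{E^{[1]}\cdots E^{[1]}}_{d}E^{[2]}_{(d)}\to E^{[0]}$; $\underbrace{E^{[1]}\cdots E^{[1]}}_{d+1}\to E^{[2]}$. \end{itemize}
   Context: Fix a field $\mathbb F$. All graded algebras $A=\mathbb F\oplus A_1\oplus A_2\oplus\cdots$ are locally finite, connected and generated in degree 1; $\mathbb F$ also denotes the trivial graded left module $A/A_{\ge 1}$. Put $E(A)=\bigoplus_{p,j}E^p_j(A)$ with $E^p_j(A)=\underline{\mathrm{Ext}}^p_A(\mathbb F,\mathbb F)_{-j}$, where $\underline{\mathrm{Ext}}$ is the derived functor of $\underline{\mathrm{Hom}}_A(M,N)=\bigoplus_n\mathrm{Hom}_{Gr(A)}(M,N[n])$ (degree-zero graded maps, $N[n]_j=N_{n+j}$); $p$ is the cohomological degree and $j$ the lower grading; $E^p(A)=\bigoplus_j E^p_j(A)$. For $d\ge2$ let $\varDelta_d(3k)=(2dk,2dk)$, $\varDelta_d(3k+1)=(2dk+1,2dk+1)$, $\varDelta_d(3k+2)=(2dk+d,2dk+d+1)$ for $k\ge 0$. $A$ is a bi-Koszul algebra determined by $\varDelta_d$ if the trivial module $\mathbb F$ has a minimal graded free resolution $P$ in which $P_n$ is generated in degrees $\varDelta_d(n)$ (the pair viewed as a set) for all $n\ge0$. Notation: $E^{[r]}=\bigoplus_{k\ge0}E^{3k+r}$ for $r=0,1,2$; $E^{[2]}_{(d)}=\bigoplus_k E^{3k+2}_{2dk+d}$ and $E^{[2]}_{(d+1)}=\bigoplus_kE^{3k+2}_{2dk+d+1}$,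 so $E^{[2]}=E^{[2]}_{(d)}\oplus E^{[2]}_{(d+1)}$. An $A_\infty$-algebra is a $\mathbb Z$-graded vector space $E$ with linear maps $m_n:E^{\otimes n}\to E$ of degree $2-n$ ($n\ge1$) such that for all $n\ge1$, $\sum(-1)^{i+jt}m_{i+1+j}(1^{\otimes i}\otimes m_t\otimes 1^{\otimes j})=0$, the sum over $n=i+t+j$, $i,j\ge0$, $t\ge1$. All $A_\infty$-algebras are strictly unital ($1\in E$ is a two-sided unit for $m_2$, and $m_n(x_1,\dots,x_n)=0$ for $n\ne2$ if some $x_i=1$). An $A_\infty$-Ext-algebra structure on $E(A)$ is one obtained by the minimality theorem (Kadeishvili) from the differential graded algebra $\mathrm{End}_A(P)$, $P$ a free resolution of ${}_A\mathbb F$: thus $m_1=0$, $m_2$ is the Yoneda product, every $m_n$ preserves the lower grading, and $E(A)$ is quasi-isomorphic to $\mathrm{End}_A(P)$. *)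

(* Defs.v *)
From HB Require Import structures.
From Stdlib Require List.
From mathcomp Require Import all_boot all_order all_algebra.
From mathcomp Require Import ring_quotient.
From mathcomp Require Import boolp classical_sets functions.

Set Implicit Arguments.
Unset Strict Implicit.
Unset Printing Implicit Defensive.

Import Order.TTheory GRing.Theory Num.Theory.

Local Open Scope classical_set_scope.
Local Open Scope ring_scope.
Local Open Scope quotient_scope.

(* Gradings are internal: a graded object is a total space with a family of
   homogeneous components. *)

Definition sum_of (I : Type) (V : zmodType) (C : I -> set V) : set V :=
  [set v | exists2 s : seq V,
     (forall x, x \in s -> exists i, C i x) & v = \sum_(x <- s) x].

Definition is_grading (I : eqType) (V : zmodType) (C : I -> set V) : Prop :=
  [/\ forall i, C i 0 /\ (forall x y, C i x -> C i y -> C i (x - y)),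
      forall v, sum_of C v &
      forall (s : seq I) (w : I -> V), uniq s -> (forall i, C i (w i)) ->
        \sum_(i <- s) w i = 0 -> forall i, i \in s -> w i = 0].

(* [ga_aug] is the projection of A onto A / A_{>=1} = F; the other fields
   determine it, so it is not extra structure. *)
Record galgebra (F : fieldType) := GAlgebra {
  ga_sort :> algType F;
  ga_comp : nat -> set ga_sort;
  ga_grading : is_grading ga_comp;
  ga_scale : forall i (c : F) a, ga_comp i a -> ga_comp i (c *: a);
  ga_mul : forall i j a b, ga_comp i a -> ga_comp j b ->
    ga_comp (i + j)%N (a * b);
  ga_connected : forall a, ga_comp 0%N a <-> exists c : F, a = c%:A;
  ga_aug : {rmorphism ga_sort -> F};
  ga_aug_scalar : forall c : F, ga_aug c%:A = c;
  ga_aug_pos : forall i a, ga_comp i.+1 a -> ga_aug a = 0;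
  ga_locally_finite : forall i, exists s : seq ga_sort,
    forall a, ga_comp i a ->
      exists c : nat -> F, a = \sum_(k < size s) c k *: s`_k;
  ga_generated1 : forall S : set ga_sort,
    S 1 -> (forall (c : F) a b, S a -> S b -> S (c *: a + b)) ->
    (forall a b, S a -> S b -> S (a * b)) ->
    (forall a, ga_comp 1%N a -> S a) -> forall a, S a
}.

Definition ga_pos (F : fieldType) (A : galgebra F) : set A :=
  sum_of (fun i : nat => @ga_comp F A i.+1).

(* A complex of graded left A-modules is stored as its total module; [cx_comp n i]
   is the part of homological degree n and internal degree i. *)

Record gcomplex (F : fieldType) (A : galgebra F) := GComplex {
  cx_sort :> lmodType A;
  cx_comp : int -> int -> set cx_sort;
  cx_grading : is_grading (fun k : int * int => cx_comp k.1 k.2);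
  cx_act : forall j n i (a : A) x, ga_comp j a -> cx_comp n i x ->
    cx_comp n (j%:Z + i) (a *: x);
  cx_d : {linear cx_sort -> cx_sort};
  cx_d_deg : forall n i x, cx_comp n i x -> cx_comp (n - 1) i (cx_d x);
  cx_dd : forall x, cx_d (cx_d x) = 0
}.

Arguments cx_comp {F A} g n i _.

Definition cx_obj (F : fieldType) (A : galgebra F) (P : gcomplex A) (n : int) :
  set P := sum_of (fun i : int => cx_comp P n i).

(* The trivial module, used below as a complex concentrated in bidegree (0, 0). *)

Definition triv (F : fieldType) (A : galgebra F) : Type := F.

Section Triv.
Variables (F : fieldType) (A : galgebra F).

HB.instance Definition _ := GRing.Zmodule.on (triv A).

Definition triv_scale (a : A) (c : triv A) : triv A := ga_aug A a * (c : F).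

Fact triv_scaleA a b v :
  triv_scale a (triv_scale b v) = triv_scale (a * b) v.
Proof. by rewrite /triv_scale rmorphM mulrA. Qed.

Fact triv_scale1 : left_id 1 triv_scale.
Proof. by move=> v; rewrite /triv_scale rmorph1 mul1r. Qed.

Fact triv_scaleDr : right_distributive triv_scale +%R.
Proof. by move=> a u v; rewrite /triv_scale; exact: mulrDr. Qed.

Fact triv_scaleDl v : {morph triv_scale^~ v : a b / a + b}.
Proof. by move=> a b; rewrite /triv_scale rmorphD mulrDl. Qed.

HB.instance Definition _ := GRing.Zmodule_isLmodule.Build A (triv A)
  triv_scaleA triv_scale1 triv_scaleDr triv_scaleDl.

Definition triv_comp (n i : int) : set (triv A) :=
  [set v | v = 0 \/ n = 0 /\ i = 0].

Fact triv_grading : is_grading (fun k : int * int => triv_comp k.1 k.2).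
Proof.
split=> [k|v|s w us Cw].
- split=> [|x y [->|k0] [->|k0']]; try by right.
    by left.
  by left; rewrite subr0.
- exists [:: v]; last by rewrite big_seq1.
  by move=> x _; exists (0, 0); right.
- have w0 i : i != (0, 0) -> w i = 0.
    case: (Cw i) => // -[i1 i2] /negP[]; apply/eqP.
    by case: i i1 i2 {Cw} => /= ? ? -> ->.
  have [s00|s00] := boolP ((0, 0) \in s); last first.
    by move=> _ i si; apply: w0; apply: contraNneq s00 => <-.
  rewrite (bigD1_seq (0, 0)) //= big1 ?addr0 => [e i _|i /w0 //].
  by have [->|/w0] := eqVneq i (0, 0).
Qed.

Fact triv_act j n i (a : A) x : ga_comp j a -> triv_comp n i x ->
  triv_comp n (j%:Z + i) (a *: x).
Proof.
case: j => [|j] Ca [->|[-> ->]]; rewrite ?scaler0; try by left.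
- by right.
- by left; rewrite /GRing.scale /= /triv_scale (ga_aug_pos Ca) mul0r.
Qed.

Fact triv_d_deg n i x : triv_comp n i x ->
  triv_comp (n - 1) i ((\0 : {linear triv A -> triv A}) x).
Proof. by left. Qed.

Fact triv_dd x : (\0 : {linear triv A -> triv A})
  ((\0 : {linear triv A -> triv A}) x) = 0.
Proof. by []. Qed.

Definition triv_cx : gcomplex A :=
  GComplex triv_grading triv_act triv_d_deg triv_dd.

End Triv.

(* The space of all functions P -> Q; c : F acts through c%:A. *)
Definition fmap (F : fieldType) (A : galgebra F) (P Q : gcomplex A) : Type :=
  P -> Q.

Section Fmap.
Variables (F : fieldType) (A : galgebra F) (P Q : gcomplex A).

HB.instance Definition _ := GRing.Zmodule.copy (fmap P Q) (P -> Q).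

Definition fmap_scale (c : F) (f : fmap P Q) : fmap P Q :=
  fun x => (c%:A : A) *: f x.

Fact fmap_scaleA a b v : fmap_scale a (fmap_scale b v) = fmap_scale (a * b) v.
Proof.
by apply/funext=> x; rewrite /fmap_scale scalerA -scalerAl mul1r scalerA.
Qed.

Fact fmap_scale1 : left_id 1 fmap_scale.
Proof. by move=> v; apply/funext=> x; rewrite /fmap_scale !scale1r. Qed.

Fact fmap_scaleDr : right_distributive fmap_scale +%R.
Proof. by move=> a u v; apply/funext=> x; exact: scalerDr. Qed.

Fact fmap_scaleDl v : {morph fmap_scale^~ v : a b / a + b}.
Proof.
by move=> a b; apply/funext=> x; rewrite /fmap_scale scalerDl scalerDl.
Qed.

HB.instance Definition _ := GRing.Zmodule_isLmodule.Build F (fmap P Q)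
  fmap_scaleA fmap_scale1 fmap_scaleDr fmap_scaleDl.

(* A-linear maps P_{n,i} -> Q_{n-p,i+q}, for all n and i: cohomological degree
   p and internal degree q. *)
Definition hom_comp (p q : int) : set (fmap P Q) :=
  [set f | linear (f : P -> Q) /\
           forall n i x, cx_comp P n i x -> cx_comp Q (n - p) (i + q) (f x)].

Definition hom_d (p : int) (f : fmap P Q) : fmap P Q :=
  (cx_d Q \o f : fmap P Q) - ((-1 : F) ^ p) *: (f \o cx_d P : fmap P Q).

Definition cocycle_comp (p q : int) : set (fmap P Q) :=
  [set f | hom_comp p q f /\ hom_d p f = 0].

Definition coboundary_comp (p q : int) : set (fmap P Q) :=
  [set f | exists2 g, hom_comp (p - 1) q g & f = hom_d (p - 1) g].

Definition cocycle : {pred fmap P Q} :=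
  fun f => `[< sum_of (fun k : int * int => cocycle_comp k.1 k.2) f >].

Definition coboundary : {pred fmap P Q} :=
  fun f => `[< sum_of (fun k : int * int => coboundary_comp k.1 k.2) f >].

Lemma sum_of_submod (I : Type) (C : I -> set (fmap P Q)) :
  (forall i c f, C i f -> C i (c *: f)) ->
  submod_closed [pred f | `[< sum_of C f >]].
Proof.
move=> CZ; split=> [|c f g].
  by apply/(@asboolP (sum_of C 0)); exists [::] => //; rewrite big_nil.
move=> /(@asboolP (sum_of C f))[s sC ->] /(@asboolP (sum_of C g))[t tC ->].
apply/(@asboolP (sum_of C _)).
exists ([seq c *: x | x <- s] ++ t); last first.
  by rewrite big_cat big_map /= scaler_sumr.
move=> x; rewrite mem_cat => /orP[/mapP[y ys ->]|/tC //].
by have [i Ci] := sC _ ys; exists i; apply: CZ.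
Qed.

Lemma hom_comp_scale p q c f : hom_comp p q f -> hom_comp p q (c *: f).
Proof.
have E x : (c *: f) x = (c%:A : A) *: f x by [].
case=> fl fd; split=> [a x y|n i x Cx]; rewrite !E.
  rewrite (fl a x y) scalerDr; congr (_ + _).
  by rewrite !scalerA -scalerAl mul1r -scalerAr mulr1.
have := @cx_act _ _ Q 0%N (n - p) (i + q) (c%:A) (f x); rewrite add0r.
by apply; [apply/ga_connected; exists c | exact: fd].
Qed.

Lemma hom_d_scale p c (f : fmap P Q) : hom_d p (c *: f) = c *: hom_d p f.
Proof.
rewrite /hom_d scalerBr !scalerA (mulrC c) -scalerA.
congr (_ - _); apply/funext=> x /=.
exact: (linearZZ (cx_d Q)).
Qed.

Fact cocycle_submod : submod_closed cocycle.
Proof.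
apply: sum_of_submod => k c f [hf df]; split; first exact: hom_comp_scale.
by rewrite hom_d_scale df scaler0.
Qed.

Fact coboundary_submod : submod_closed coboundary.
Proof.
apply: sum_of_submod => k c f [g hg ->].
by exists (c *: g); [exact: hom_comp_scale | rewrite hom_d_scale].
Qed.

HB.instance Definition _ :=
  GRing.isSubmodClosed.Build F (fmap P Q) cocycle cocycle_submod.
HB.instance Definition _ :=
  GRing.isSubmodClosed.Build F (fmap P Q) coboundary coboundary_submod.

Record cocycles := Cocycles {
  cocycle_val :> fmap P Q;
  _ : cocycle_val \in cocycle
}.

HB.instance Definition _ := [isSub for cocycle_val].
HB.instance Definition _ := [Choice of cocycles by <:].
HB.instance Definition _ := [SubChoice_isSubLmodule of cocycles by <:].

Definition cobound : {pred cocycles} := fun z => val z \in coboundary.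

Fact cobound_submod : submod_closed cobound.
Proof.
split=> [|c x y]; first exact: (rpred0 coboundary).
by move=> xB yB; apply: (rpredD (rpredZ c xB) yB).
Qed.

HB.instance Definition _ :=
  GRing.isSubmodClosed.Build F cocycles cobound cobound_submod.

Definition coh : Type := Quotient.quot cobound.

HB.instance Definition _ := GRing.Zmodule.on coh.

Definition coh_pi (z : cocycles) : coh := \pi_(Quotient.quot cobound) z.

Definition coh_scale (c : F) (h : coh) : coh :=
  coh_pi (c *: (repr (h : Quotient.quot cobound))).

Lemma coh_scale_pi c z : coh_scale c (coh_pi z) = coh_pi (c *: z).
Proof.
apply/eqP; rewrite /coh_scale /coh_pi -Quotient.idealrBE -scalerBr.
by apply: rpredZ; rewrite Quotient.idealrBE reprK.
Qed.

Lemma coh_piD x y : coh_pi (x + y) = coh_pi x + coh_pi y.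
Proof. exact: (raddfD \pi_(Quotient.quot cobound)). Qed.

Lemma coh_piP h : exists z, h = coh_pi z.
Proof. by exists (repr (h : Quotient.quot cobound)); rewrite /coh_pi reprK. Qed.

Fact coh_scaleA a b v : coh_scale a (coh_scale b v) = coh_scale (a * b) v.
Proof. by have [z ->] := coh_piP v; rewrite !coh_scale_pi scalerA. Qed.

Fact coh_scale1 : left_id 1 coh_scale.
Proof. by move=> v; have [z ->] := coh_piP v; rewrite coh_scale_pi scale1r. Qed.

Fact coh_scaleDr : right_distributive coh_scale +%R.
Proof.
move=> a u v; have [x ->] := coh_piP u; have [y ->] := coh_piP v.
by rewrite -coh_piD !coh_scale_pi scalerDr coh_piD.
Qed.

Fact coh_scaleDl v : {morph coh_scale^~ v : a b / a + b}.
Proof.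
by move=> a b; have [x ->] := coh_piP v; rewrite !coh_scale_pi scalerDl coh_piD.
Qed.

HB.instance Definition _ := GRing.Zmodule_isLmodule.Build F coh
  coh_scaleA coh_scale1 coh_scaleDr coh_scaleDl.

(* Cohomology class of a cocycle; 0 on functions that are not cocycles. *)
Definition cls (f : fmap P Q) : coh := coh_pi (insubd (0 : cocycles) f).

Lemma cls_eq (f g : fmap P Q) : f \in cocycle -> g \in cocycle ->
  (cls f = cls g <-> f - g \in coboundary).
Proof.
move=> fZ gZ; rewrite /cls /coh_pi.
have -> : (f - g \in coboundary) =
    (insubd (0 : cocycles) f - insubd (0 : cocycles) g \in cobound).
  by rewrite [RHS]unfold_in /cobound (raddfB val) /= !insubdK.
by rewrite Quotient.idealrBE; split=> [->|/eqP].
Qed.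

Definition coh_comp (p q : int) : set coh :=
  [set h | exists2 f, cocycle_comp p q f & h = cls f].

End Fmap.

Section Resolutions.
Variables (F : fieldType) (A : galgebra F).

Definition graded_free (P : gcomplex A) (n : int) : Prop :=
  exists (I : eqType) (b : I -> P) (deg : I -> int),
  [/\ forall i, cx_comp P n (deg i) (b i),
      forall x, cx_obj n x ->
        exists (s : seq I) (a : I -> A), x = \sum_(i <- s) a i *: b i &
      forall (s : seq I) (a : I -> A), uniq s ->
        \sum_(i <- s) a i *: b i = 0 -> forall i, i \in s -> a i = 0].

Record resolution := Resolution {
  res_cx :> gcomplex A;
  res_aug : {linear res_cx -> triv_cx A};
  res_aug_deg : hom_comp 0 0 (res_aug : fmap res_cx (triv_cx A));
  res_nonneg : forall (n : int) (x : res_cx), n < 0 -> cx_obj n x -> x = 0;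
  res_free : forall n, graded_free res_cx n;
  res_exact : forall (n : int) (x : res_cx),
    0 < n -> cx_obj n x -> cx_d res_cx x = 0 ->
    exists y : res_cx, cx_d res_cx y = x;
  res_exact0 : forall x : res_cx, cx_obj 0 x ->
    (res_aug x = 0 <-> exists y : res_cx, cx_d res_cx y = x);
  res_aug_surj : forall c : triv_cx A, exists x, res_aug x = c
}.

Definition minimal (P : gcomplex A) : Prop :=
  forall x : P, exists2 s : seq (A * P),
    (forall k, k \in s -> ga_pos k.1) & cx_d P x = \sum_(k <- s) k.1 *: k.2.

Definition generated_in (P : gcomplex A) (n : int) (D : set int) : Prop :=
  forall x : P, cx_obj n x -> exists2 s : seq (A * P),
    (forall k, k \in s -> exists2 i, D i & cx_comp P n i k.2) &
    x = \sum_(k <- s) k.1 *: k.2.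

Definition Delta (d n : nat) : nat * nat :=
  let k := (n %/ 3)%N in
  match (n %% 3)%N with
  | 0 => (2 * d * k, 2 * d * k)
  | 1 => (2 * d * k + 1, 2 * d * k + 1)
  | _ => (2 * d * k + d, 2 * d * k + d + 1)
  end%N.

Definition bi_Koszul (d : nat) : Prop :=
  exists P : resolution, minimal P /\
    forall n : nat, generated_in P n%:Z
      [set i | i = (Delta d n).1%:Z \/ i = (Delta d n).2%:Z].

(* [Ext P] is E(A) computed with the resolution P; the lower degree j is minus
   the internal degree. *)

Definition Ext (P : resolution) : Type := coh P (triv_cx A).

HB.instance Definition _ (P : resolution) := GRing.Lmodule.on (Ext P).

Definition Ext_comp (P : resolution) (p j : int) : set (Ext P) :=
  @coh_comp F A P (triv_cx A) p (- j).

Definition Ext_deg (P : resolution) (p : int) : set (Ext P) :=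
  sum_of (@Ext_comp P p).

End Resolutions.

Arguments Ext_comp {F A} P p j _.
Arguments Ext_deg {F A} P p _.

(* A family of linear maps E^{(x) n} -> V (n >= 1) is a function
   [g : seq E -> V] that is multilinear in the entries; g_n is its restriction
   to sequences of length n, and the value at the empty sequence is unused. *)

Section Ainfinity.
Variables (F : fieldType) (E : lmodType F) (C : int -> set E).

Definition multilinear (V : lmodType F) (g : seq E -> V) : Prop :=
  forall (s1 s2 : seq E) (a : F) (x y : E),
    g (s1 ++ (a *: x + y) :: s2) = a *: g (s1 ++ x :: s2) + g (s1 ++ y :: s2).

(* Value at s of the sum over n = i + t + j of
   (-1)^(i + j t) g_(i+1+j) (1^i (x) m_t (x) 1^j), where ps lists the degrees
   of the entries of s; the second sign is the Koszul sign of moving m_t, of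
   degree 2 - t, past the first i entries. *)
Definition stasheff (V : lmodType F) (g : seq E -> V) (m : seq E -> E)
    (ps : seq int) (s : seq E) : V :=
  let n := size s in
  \sum_(1 <= t < n.+1) \sum_(0 <= i < (n - t).+1)
    let j := (n - t - i)%N in
    ((-1 : F) ^+ (i + j * t) *
     (-1 : F) ^ ((2 - t%:Z) * \sum_(p <- take i ps) p)) *:
    g (take i s ++ m (take t (drop i s)) :: drop (i + t) s).

Definition strictly_unital (u : E) (m : seq E -> E) : Prop :=
  [/\ C 0 u, forall x, m [:: u; x] = x /\ m [:: x; u] = x &
      forall s, u \in s -> size s != 2%N -> m s = 0].

Definition Ainf_algebra (u : E) (m : seq E -> E) : Prop :=
  [/\ multilinear m,
      forall ps s, (0 < size s)%N -> List.Forall2 C ps s ->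
        C (\sum_(p <- ps) p + 2 - (size s)%:Z) (m s),
      forall ps s, (0 < size s)%N -> List.Forall2 C ps s -> stasheff m m ps s = 0 &
      strictly_unital u m].

End Ainfinity.

Section AinfExt.
Variables (F : fieldType) (A : galgebra F) (P : resolution A).

Let bihom (k : int * int) : set (Ext P) := Ext_comp P k.1 k.2.

Let aug_comp (f : fmap P P) : fmap P (triv_cx A) := res_aug P \o f.

(* An A-infinity morphism from (Ext P, m) to the differential graded algebra
   End_A(P), seen as an A-infinity algebra with m_1 = hom_d, m_2 = composition
   and m_n = 0 for n >= 3. *)
Definition Ainf_morphism_End (m : seq (Ext P) -> Ext P)
    (f : seq (Ext P) -> fmap P P) : Prop :=
  [/\ multilinear f,
      forall ks s, (0 < size s)%N -> List.Forall2 bihom ks s ->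
        hom_comp (\sum_(k <- ks) k.1 + 1 - (size s)%:Z)
                 (- \sum_(k <- ks) k.2) (f s) &
      forall ps s, (0 < size s)%N -> List.Forall2 (Ext_deg P) ps s ->
        stasheff f m ps s =
        hom_d (\sum_(p <- ps) p + 1 - (size s)%:Z) (f s) +
        \sum_(1 <= i < size s)
          ((-1 : F) ^+ i.-1 *
           (-1 : F) ^ ((1 - (size s - i)%N%:Z) * \sum_(p <- take i ps) p)) *:
          (f (take i s) \o f (drop i s) : fmap P P)].

Definition Ainf_Ext_structure (m : seq (Ext P) -> Ext P) : Prop :=
  [/\ Ainf_algebra (Ext_deg P) (cls (res_aug P)) m,
      forall x, m [:: x] = 0,
      (* m_2 is the Yoneda product: the classes of P -> F are lifted to
         cocycles u, v of End_A(P), which are then composed *)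
      forall (p q p' q' : int) (u v : fmap P P),
        cocycle_comp p q u -> cocycle_comp p' q' v ->
        m [:: cls (aug_comp u); cls (aug_comp v)] = cls (aug_comp (u \o v)),
      forall ks s, (0 < size s)%N -> List.Forall2 bihom ks s ->
        Ext_comp P (\sum_(k <- ks) k.1 + 2 - (size s)%:Z)
                   (\sum_(k <- ks) k.2) (m s) &
      (* a quasi-isomorphism inducing the canonical identification of E(A)
         with the cohomology of End_A(P) *)
      exists f : seq (Ext P) -> fmap P P,
        [/\ Ainf_morphism_End m f,
            bijective (fun x => cls (f [:: x])) &
            forall x, cls (aug_comp (f [:: x])) = x]].

End AinfExt.

(* In this order: E^[0], E^[1], E^[2], E^[2]_(d), E^[2]_(d+1). *)
Inductive piece := E0 | E1 | E2 | E2d | E2d1.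

Definition piece_code (p : piece) : nat :=
  match p with E0 => 0 | E1 => 1 | E2 => 2 | E2d => 3 | E2d1 => 4 end.

Definition piece_decode (n : nat) : piece :=
  match n with 0 => E0 | 1 => E1 | 2 => E2 | 3 => E2d | _ => E2d1 end.

Fact piece_codeK : cancel piece_code piece_decode.
Proof. by case. Qed.

HB.instance Definition _ := Equality.copy piece (can_type piece_codeK).

Definition piece_set (F : fieldType) (A : galgebra F) (P : resolution A)
    (d : nat) (p : piece) : set (Ext P) :=
  match p with
  | E0 => sum_of (fun k : nat => Ext_deg P (3 * k)%N%:Z)
  | E1 => sum_of (fun k : nat => Ext_deg P (3 * k + 1)%N%:Z)
  | E2 => sum_of (fun k : nat => Ext_deg P (3 * k + 2)%N%:Z)
  | E2d => sum_of (fun k : nat =>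
      Ext_comp P (3 * k + 2)%N%:Z (2 * d * k + d)%N%:Z)
  | E2d1 => sum_of (fun k : nat =>
      Ext_comp P (3 * k + 2)%N%:Z (2 * d * k + d + 1)%N%:Z)
  end.

Arguments piece_set {F A} P d p _.

(* [(w, r)] stands for m_(size w) : w_1 (x) ... (x) w_n -> r, up to permutation
   of w. *)
Definition mult_table (d : nat) : seq (seq piece * piece) :=
  [:: ([:: E0; E0], E0);
      ([:: E0; E1], E1);
      ([:: E2d; E2d1], E1);
      ([:: E0; E2], E2);
      ([:: E0; E2d; E2d], E0);
      ([:: E1; E2d; E2d], E1);
      ([:: E0; E1; E2d], E2);
      ([:: E2; E2d; E2d], E2);
      ([:: E2d; E2d; E2d; E2d], E0);
      ([:: E1; E2d; E2d; E2d], E2);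
      (rcons (nseq d.-1 E1) E2d1, E0);
      (nseq d E1, E2);
      (rcons (nseq d E1) E2d, E0);
      (nseq d.+1 E1, E2)].

Definition basic (p : piece) : bool := p != E2.

Definition sub_piece (p q : piece) : bool :=
  (p == q) || (q == E2) && ((p == E2d) || (p == E2d1)).

Definition listed (d : nat) (w : seq piece) : Prop :=
  exists w' r, (w', r) \in mult_table d /\
    exists2 w0, perm_eq w0 w' & all2 sub_piece w w0.

(* Main.v *)
(* If Q is a resolution of F generated in degrees D(n) in homological degree n,
   comparison maps P -> Q -> P and a homotopy h from their composite to the
   identity show that a cocycle P_n -> F of internal degree outside D(n) equals
   its composite with h d, so is a coboundary. Hence E(A), computed with any P,
   lives in the bidegrees of Delta_d. As m_n has bidegree (2 - n, 0),
   multilinearity reduces the claim to bihomogeneous arguments. There the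
   cohomological degree modulo 3 gives the target piece, and the two degrees
   together leave finitely many words, which are those of the table. *)
Require Import Defs.
From HB Require Import structures.
From Stdlib Require List.
From mathcomp Require Import all_boot all_order all_algebra.
From mathcomp Require Import boolp classical_sets functions.
From mathcomp Require Import zify ring.

Set Implicit Arguments.
Unset Strict Implicit.
Unset Printing Implicit Defensive.

Import Order.TTheory GRing.Theory Num.Theory.

Local Open Scope classical_set_scope.
Local Open Scope ring_scope.

(** * Sums of homogeneous elements and gradings *)

Section SumOf.
Variables (I : Type) (V : zmodType) (C : I -> set V).

Lemma sum_of0 : sum_of C 0.
Proof. by exists [::]; rewrite ?big_nil. Qed.

Lemma sum_ofD x y : sum_of C x -> sum_of C y -> sum_of C (x + y).
Proof.
move=> [s sC ->] [t tC ->]; exists (s ++ t); rewrite ?big_cat // => z.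
by rewrite mem_cat => /orP[/sC|/tC].
Qed.

Lemma sum_of1 i x : C i x -> sum_of C x.
Proof.
move=> Cx; exists [:: x]; rewrite ?big_seq1 // => y.
by rewrite inE => /eqP ->; exists i.
Qed.

End SumOf.

Lemma sum_of_bind (I J : Type) (V : zmodType) (C : I -> set V) (D : J -> set V) :
  (forall i, C i `<=` sum_of D) -> sum_of C `<=` sum_of D.
Proof.
move=> CD x [s sC ->]; rewrite big_seq; elim/big_ind: _ => [|y z|y /sC[i /CD //]].
- exact: sum_of0.
- exact: sum_ofD.
Qed.

Section Graded.
Variables (I : eqType) (V : zmodType) (C : I -> set V).
Hypothesis CG : is_grading C.

Lemma grading0 i : C i 0.
Proof. by have [/(_ i)[]] := CG. Qed.

Lemma gradingB i x y : C i x -> C i y -> C i (x - y).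
Proof. by have [/(_ i)[]] := CG; auto. Qed.

Lemma gradingD i x y : C i x -> C i y -> C i (x + y).
Proof.
move=> Cx Cy; rewrite -[y]opprK -[- y]add0r.
by apply: gradingB => //; apply: gradingB => //; apply: grading0.
Qed.

Lemma grading_sum i (T : eqType) (s : seq T) (p : pred T) (f : T -> V) :
  (forall k, k \in s -> p k -> C i (f k)) -> C i (\sum_(k <- s | p k) f k).
Proof.
move=> Cf; rewrite big_seq_cond.
elim/big_ind: _ => [|x y|k /andP[]]; [exact: grading0|exact: gradingD|auto].
Qed.

Lemma grading_decomp x : exists2 t : seq (I * V),
  (forall k, k \in t -> C k.1 k.2) & x = \sum_(k <- t) k.2.
Proof.
have [_ /(_ x)[s sC ->] _] := CG.
elim: s sC => [|z s IHs] sC; first by exists [::]; rewrite ?big_nil.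
have [|t tC ts] := IHs; first by move=> y ys; apply: sC; rewrite in_cons ys orbT.
have [i Ci] := sC z (mem_head _ _).
exists ((i, z) :: t); last by rewrite !big_cons ts.
by move=> k; rewrite in_cons => /orP[/eqP -> //|/tC].
Qed.

End Graded.

(** Gradings and bases state uniqueness for distinct indices only; collecting terms by tag brings an
    arbitrary finite sum into that form. *)
Lemma sum_group (I T : eqType) (V : zmodType) (s : seq T) (tag : T -> I)
    (p : pred I) (f : T -> V) :
  \sum_(k <- s | p (tag k)) f k =
  \sum_(i <- undup (map tag s) | p i) \sum_(k <- s | tag k == i) f k.
Proof.
rewrite (exchange_big_dep (fun k => p (tag k))) /= => [|i k pi /eqP -> //].
rewrite big_seq_cond [RHS]big_seq_cond; apply: eq_bigr => k /andP[ks pk].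
rewrite -big_filter (_ : [seq _ <- _ | _] = [:: tag k]) ?big_seq1 //.
rewrite (eq_filter (a2 := pred1 (tag k))) => [|i]; last first.
  by rewrite /= eq_sym; case: eqP => [->|_]; rewrite ?pk ?andbT ?andbF.
by rewrite filter_pred1_uniq ?undup_uniq // mem_undup map_f.
Qed.

Section GradedIndep.
Variables (I : eqType) (V : zmodType) (C : I -> set V).
Hypothesis CG : is_grading C.

Lemma grading_indep (p : pred I) (t : seq (I * V)) :
  (forall k, k \in t -> C k.1 k.2) -> \sum_(k <- t) k.2 = 0 ->
  \sum_(k <- t | p k.1) k.2 = 0.
Proof.
move=> tC t0; rewrite (sum_group _ fst) big_seq_cond big1 // => i /andP[it _].
have [_ _ /(_ (undup (map fst t)) (fun i => \sum_(k <- t | k.1 == i) k.2))] := CG.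
apply=> //; first exact: undup_uniq.
  by move=> j; apply: grading_sum => // k /tC kC /eqP <-.
by rewrite -(sum_group t fst xpredT).
Qed.

(** Once the term [(i, - x)] is added to [t] the total is zero, so the part of degree [i] vanishes
    by itself. *)
Lemma grading_filter (i : I) (t : seq (I * V)) x :
  (forall k, k \in t -> C k.1 k.2) -> C i x -> x = \sum_(k <- t) k.2 ->
  x = \sum_(k <- t | k.1 == i) k.2.
Proof.
move=> tC Cx xt.
have Cx' : C i (- x) by rewrite -sub0r; apply: gradingB => //; apply: grading0.
have /(_ (pred1 i)) := @grading_indep _ ((i, - x) :: t).
rewrite !big_cons /= -xt addNr eqxx => H.
apply/eqP; rewrite -subr_eq0 -oppr_eq0 opprB addrC; apply/eqP; apply: H => //.
by move=> k; rewrite in_cons => /orP[/eqP -> //|/tC].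
Qed.

End GradedIndep.

(** * Linear maps as bare functions and as graphs *)

Section LinearFun.
Variables (R : pzRingType) (V W : lmodType R) (f : V -> W).
Hypothesis fL : linear f.

(** [hom_comp] records linearity as a property of a bare function; a bundled copy gives access to
    the theory of linear maps. *)
Lemma linear_fun_bundle : exists g : {linear V -> W}, f = g.
Proof.
pose g : {linear V -> W} := HB.pack f (GRing.isLinear.Build R V W _ f fL).
by exists g.
Qed.

Lemma linear_fun0 : f 0 = 0.
Proof. by have [g ->] := linear_fun_bundle; rewrite linear0. Qed.

Lemma linear_funD x y : f (x + y) = f x + f y.
Proof. by have [g ->] := linear_fun_bundle; rewrite linearD. Qed.

Lemma linear_funZ a x : f (a *: x) = a *: f x.
Proof. by have [g ->] := linear_fun_bundle; rewrite linearZ. Qed.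

Lemma linear_fun_sum (T : Type) (s : seq T) (p : pred T) (F : T -> V) :
  f (\sum_(i <- s | p i) F i) = \sum_(i <- s | p i) f (F i).
Proof. by have [g ->] := linear_fun_bundle; rewrite linear_sum. Qed.

End LinearFun.

(* A scaling-stable relation that generates and is compatible with vanishing of
   sums is the graph of a linear map on its generators. *)
Lemma linear_from_graph (R : pzRingType) (V W : lmodType R) (S : set (V * W)) :
  (forall a v w, S (v, w) -> S (a *: v, a *: w)) ->
  (forall x, exists2 t : seq (V * W),
     (forall k, k \in t -> S k) & x = \sum_(k <- t) k.1) ->
  (forall t : seq (V * W), (forall k, k \in t -> S k) ->
     \sum_(k <- t) k.1 = 0 -> \sum_(k <- t) k.2 = 0) ->
  exists2 f : V -> W, linear f & forall v w, S (v, w) -> f v = w.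
Proof.
move=> SZ Sgen S0.
have /choice[c cP] x : exists t : seq (V * W),
    (forall k, k \in t -> S k) /\ x = \sum_(k <- t) k.1.
  by have [t] := Sgen x; exists t.
pose f x := \sum_(k <- c x) k.2.
have Zt a (t : seq (V * W)) : (forall k, k \in t -> S k) ->
    forall k, k \in [seq (a *: k.1, a *: k.2) | k <- t] -> S k.
  by move=> tS k /mapP[[v w] kt ->]; apply/SZ/tS.
have cat (t1 t2 : seq (V * W)) :
    (forall k, k \in t1 -> S k) -> (forall k, k \in t2 -> S k) ->
    forall k, k \in t1 ++ t2 -> S k.
  by move=> h1 h2 k; rewrite mem_cat => /orP[/h1|/h2].
have fE t : (forall k, k \in t -> S k) ->
    f (\sum_(k <- t) k.1) = \sum_(k <- t) k.2.
  move=> tS; have [cS xc] := cP (\sum_(k <- t) k.1).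
  (* The chosen list followed by the negative of [t] has first coordinates adding up to 0, hence
     also second ones: [f] does not depend on the choice [c]. *)
  have := S0 _ (cat _ _ cS (Zt (-1) _ tS)).
  rewrite !big_cat !big_map /= -!scaler_sumr -xc !scaleN1r subrr => /(_ erefl).
  by move/eqP; rewrite subr_eq0 => /eqP.
exists f => [a x y|v w Svw]; last first.
  by have := fE [:: (v, w)]; rewrite !big_seq1; apply=> k; rewrite inE => /eqP ->.
have [xS {1}->] := cP x; have [yS {1}->] := cP y.
have := fE _ (cat _ _ (Zt a _ xS) yS).
by rewrite !big_cat !big_map /= -!scaler_sumr.
Qed.

(** * Graded complexes and lifting from graded free modules *)

Section Complexes.
Variables (F : fieldType) (A : galgebra F).
Implicit Types P Q R : gcomplex A.

Lemma cx_obj_comp P n i (x : P) : cx_comp P n i x -> cx_obj n x.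
Proof. by move=> Cx; apply: (sum_of1 (i := i)). Qed.

Lemma cx_obj_sum P n (T : eqType) (s : seq T) (p : pred T) (f : T -> P) :
  (forall k, k \in s -> p k -> cx_obj n (f k)) ->
  cx_obj n (\sum_(k <- s | p k) f k).
Proof.
move=> Cf; rewrite big_seq_cond.
elim/big_ind: _ => [|_ _ [s1 h1 ->] [s2 h2 ->]|k /andP[]]; last by auto.
  by exists [::]; rewrite ?big_nil.
exists (s1 ++ s2); rewrite ?big_cat // => x.
by rewrite mem_cat => /orP[/h1|/h2].
Qed.

Lemma cx_obj_scale P n (a : A) (x : P) : cx_obj n x -> cx_obj n (a *: x).
Proof.
have [t tA ->] := grading_decomp (ga_grading A) a.
case=> s sC ->; rewrite scaler_suml; apply: cx_obj_sum => k kt _.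
rewrite scaler_sumr; apply: cx_obj_sum => y ys _.
have [i Ci] := sC _ ys.
exact: cx_obj_comp (cx_act (tA _ kt) Ci).
Qed.

Lemma cx_obj_decomp P n (x : P) : cx_obj n x -> exists2 t : seq ((int * int) * P),
  (forall k, k \in t -> k.1.1 = n /\ cx_comp P k.1.1 k.1.2 k.2) &
  x = \sum_(k <- t) k.2.
Proof.
case=> s sC ->; elim: s sC => [|z s IHs] sC; first by exists [::]; rewrite ?big_nil.
have [|t tC ts] := IHs; first by move=> y ys; apply: sC; rewrite in_cons ys orbT.
have [i Ci] := sC z (mem_head _ _).
exists (((n, i), z) :: t); last by rewrite !big_cons ts.
by move=> k; rewrite in_cons => /orP[/eqP -> //|/tC].
Qed.

(** After splitting into bihomogeneous terms, those of homological degree [n] are exactly the terms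
    of [x]. *)
Lemma cx_obj_indep P n (x : P) (t : seq (int * P)) : cx_obj n x ->
  (forall k, k \in t -> k.1 != n /\ cx_obj k.1 k.2) ->
  x + \sum_(k <- t) k.2 = 0 -> x = 0.
Proof.
move=> /cx_obj_decomp[u uC xu] tC.
have {tC}[v vC ->] : exists2 v : seq ((int * int) * P),
   (forall k, k \in v -> k.1.1 != n /\ cx_comp P k.1.1 k.1.2 k.2) &
   \sum_(k <- t) k.2 = \sum_(k <- v) k.2.
  elim: t tC => [|[m z] t IHt] tC; first by exists [::]; rewrite ?big_nil.
  have [k kt|v vC tv] := IHt; first by apply: tC; rewrite in_cons kt orbT.
  have [/= mn /cx_obj_decomp[w wC zw]] := tC _ (mem_head _ _).
  exists (w ++ v); last by rewrite big_cons tv zw big_cat.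
  by move=> k; rewrite mem_cat => /orP[/wC[e]|/vC //]; rewrite e.
rewrite xu -big_cat => /(grading_indep (cx_grading P) (fun k => k.1 == n)).
rewrite big_cat /= [X in _ + X]big_seq_cond.
rewrite [X in _ + X]big1 => [|k /andP[/vC[/negbTE ->]] //].
rewrite addr0 big_seq_cond (eq_bigl (fun k => k \in u)) -?big_seq => [|k]; last first.
  by case kt: (k \in u) => //=; have [->] := uC _ kt; rewrite eqxx.
by apply=> k; rewrite mem_cat => /orP[/uC[]|/vC[]].
Qed.

Lemma free_extension P Q n (I : eqType) (b : I -> P) (y : I -> Q) :
  (forall i, cx_obj n (b i)) ->
  (forall x, cx_obj n x ->
        exists (s : seq I) (a : I -> A), x = \sum_(i <- s) a i *: b i) ->
  (forall (s : seq I) (a : I -> A), uniq s ->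
        \sum_(i <- s) a i *: b i = 0 -> forall i, i \in s -> a i = 0) ->
  exists f : P -> Q, [/\ linear f, forall i, f (b i) = y i &
    forall k x, k != n -> cx_obj k x -> f x = 0].
Proof.
move=> bC bgen bfree.
(* Graph of the wanted map: multiples of basis elements in degree [n], and zero on all other
   homological degrees. *)
pose S : set (P * Q) := [set k | (exists a i, k = (a *: b i, a *: y i)) \/
  exists2 l, l != n & cx_obj l k.1 /\ k.2 = 0].
have [|x|t tS|f fL fS] := @linear_from_graph A P Q S.
- move=> a v w [[c [i [-> ->]]]|[l ln /= [Cl ->]]].
    by left; exists (a * c), i; rewrite !scalerA.
  by right; exists l => //=; rewrite scaler0; split=> //; apply: cx_obj_scale.
- have [t tC ->] := grading_decomp (cx_grading P) x.
  elim: t tC => [|[[m l] z] t IHt] tC; first by exists [::]; rewrite ?big_nil.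
  have [k kt|v vS tv] := IHt; first by apply: tC; rewrite in_cons kt orbT.
  have /= zC := tC _ (mem_head _ _).
  have [mn|mn] := eqVneq m n; last first.
    exists ((z, 0) :: v); last by rewrite !big_cons tv.
    move=> k; rewrite in_cons => /orP[/eqP ->|/vS //]; right; exists m => //.
    by split=> //; apply: cx_obj_comp zC.
  have [s [a za]] : exists (s : seq I) (a : I -> A), z = \sum_(i <- s) a i *: b i.
    by apply: bgen; rewrite -mn; apply: cx_obj_comp zC.
  exists ([seq (a i *: b i, a i *: y i) | i <- s] ++ v); last first.
    by rewrite big_cat big_map big_cons /= tv za.
  move=> k; rewrite mem_cat => /orP[/mapP[i _ ->]|/vS //].
  by left; exists (a i), i.
(* [u] collects the multiples of basis elements and [v] the terms of other homological degrees,
   which separate off by independence. *)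
- have [u [v [vC E1 E2]]] : exists (u : seq (A * I)) (v : seq (int * P)),
    [/\ forall k, k \in v -> k.1 != n /\ cx_obj k.1 k.2,
     \sum_(k <- t) k.1 = \sum_(k <- u) k.1 *: b k.2 + \sum_(k <- v) k.2 &
     \sum_(k <- t) k.2 = \sum_(k <- u) k.1 *: y k.2].
    elim: t tS => [|z t IHt] tS; first by exists [::], [::]; rewrite !big_nil addr0.
    have [k kt|u [v [vC E1 E2]]] := IHt; first by apply: tS; rewrite in_cons kt orbT.
    have [[a [i ->]]|[l ln [Cl z2]]] := tS _ (mem_head _ _).
      by exists ((a, i) :: u), v; rewrite !big_cons /= E1 E2 addrA.
    exists u, ((l, z.1) :: v); rewrite !big_cons z2 E1 E2 add0r addrCA; split=> // k.
    by rewrite in_cons => /orP[/eqP ->|/vC].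
  have uC : cx_obj n (\sum_(k <- u) k.1 *: b k.2).
    by apply: cx_obj_sum => k _ _; apply: cx_obj_scale.
  rewrite E1 E2 => /(cx_obj_indep uC vC).
  have grp (V : lmodType A) (e : I -> V) : \sum_(k <- u) k.1 *: e k.2 =
     \sum_(i <- undup (map snd u)) (\sum_(k <- u | k.2 == i) k.1) *: e i.
    rewrite (sum_group u snd xpredT); apply: eq_bigr => i _.
    by rewrite scaler_suml; apply: eq_bigr => k /eqP ->.
  rewrite !grp => /(bfree _ _ (undup_uniq _)) c0.
  by rewrite big_seq big1 // => i iu; rewrite c0 ?scale0r.
- exists f; split=> // [i|k x kn xC].
    by apply: fS; left; exists 1, i; rewrite !scale1r.
  by apply: fS; right; exists k.
Qed.

(** Take for [z] the component of [x] of bidegree [(n, i)]. As [f] shifts bidegrees injectively,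
    [f z] is the component of [f x] of bidegree [(n - p, i)], which is all of [f x]. *)
Lemma hom_comp_preimage P Q (f : fmap P Q) p n i x : hom_comp p 0 f ->
  cx_comp Q (n - p) i (f x) -> exists2 z, cx_comp P n i z & f z = f x.
Proof.
case=> fL fd fx; have [t tC xt] := grading_decomp (cx_grading P) x.
exists (\sum_(k <- t | k.1 == (n, i)) k.2).
  by apply: (grading_sum (cx_grading P) (i := (n, i))) => k /tC kC /eqP <-.
pose g (k : (int * int) * P) := ((k.1.1 - p, k.1.2), f k.2).
have := @grading_filter _ _ _ (cx_grading Q) (n - p, i) (map g t) (f x).
rewrite !big_map (linear_fun_sum fL) => -> //.
- apply: eq_bigl => -[[u v] w] /=; rewrite !xpair_eqE.
  by rewrite (inj_eq (addIr _)).
- by move=> k /mapP[[[u v] w] kt ->] /=; have := fd _ _ _ (tC _ kt); rewrite addr0.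
- by rewrite -(linear_fun_sum fL) -xt.
Qed.

(** Projectivity of a free module, with degrees: preimages of the basis elements are chosen
    homogeneous and extended linearly, by zero outside degree [n]. *)
Lemma graded_free_lift P Q R n p r (g : fmap P R) (D : fmap Q R) :
  graded_free P n -> hom_comp p 0 g -> hom_comp r 0 D ->
  (forall i x, cx_comp P n i x -> exists y, D y = g x) ->
  exists f : fmap P Q, [/\ hom_comp (p - r) 0 f,
    forall i x, cx_comp P n i x -> D (f x) = g x &
    forall k i x, k != n -> cx_comp P k i x -> f x = 0].
Proof.
move=> [I [b [deg [bC bgen bfree]]]] [gL gd] hD gD; have [DL _] := hD.
have /choice[y yP] i : exists y, cx_comp Q (n - (p - r)) (deg i) y /\ D y = g (b i).
  have [y Dy] := gD _ _ (bC i).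
  have [|z zC Dz] := @hom_comp_preimage _ _ _ _ (n - (p - r)) (deg i) y hD.
    have := gd _ _ _ (bC i); rewrite addr0 Dy.
    by rewrite (_ : n - (p - r) - r = n - p) //; ring.
  by exists z; rewrite Dz.
have [|f [fL fb f0]] := @free_extension P Q n I b y _ bgen bfree.
  by move=> i; apply: cx_obj_comp (bC i).
exists f; split=> [|i x /cx_obj_comp /bgen[s [a ->]]|k i x kn /cx_obj_comp]; last exact: f0.
  split=> // k i x xC; rewrite addr0.
  have [kn|kn] := eqVneq k n; last first.
    rewrite (f0 k x kn (cx_obj_comp xC)).
    exact: (grading0 (cx_grading Q) (k - (p - r), i)).
  rewrite {k}kn in xC *.
  have [s [a xs]] := bgen _ (cx_obj_comp xC).
  (* The coefficients [a] need not be homogeneous; they are split, and below only the terms of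
     bidegree [(n, i)] are kept. *)
  have [t tC xt] : exists2 t : seq (nat * A * I),
    (forall k, k \in t -> ga_comp k.1.1 k.1.2) & x = \sum_(k <- t) k.1.2 *: b k.2.
    rewrite xs; elim: s {xs} => [|j s [t tC IHs]]; first by exists [::]; rewrite ?big_nil.
    have [u uC ju] := grading_decomp (ga_grading A) (a j).
    exists ([seq (k, j) | k <- u] ++ t).
      by move=> k; rewrite mem_cat => /orP[/mapP[l /uC lu ->]|/tC].
    by rewrite big_cons big_cat big_map IHs ju scaler_suml.
  pose h (k : nat * A * I) := ((n, k.1.1%:Z + deg k.2), k.1.2 *: b k.2).
  rewrite (@grading_filter _ _ _ (cx_grading P) (n, i) (map h t) x) //; last first.
  - by rewrite big_map.
  - by move=> _ /mapP[k kt ->] /=; apply: cx_act => //; apply: tC.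
  rewrite big_map (linear_fun_sum fL).
  apply: (grading_sum (cx_grading Q) (i := (n - (p - r), i))) => k kt /=.
  rewrite xpair_eqE eqxx /= => /eqP <-.
  by rewrite (linear_funZ fL) fb; apply: cx_act; [apply: tC | case: (yP k.2)].
rewrite (linear_fun_sum fL) (linear_fun_sum DL) (linear_fun_sum gL).
apply: eq_bigr => j _; rewrite (linear_funZ fL) (linear_funZ DL) (linear_funZ gL) fb.
by have [_ ->] := yP j.
Qed.

End Complexes.

(** * Bidegrees of homogeneous maps *)

Section HomComp.
Variables (F : fieldType) (A : galgebra F).
Implicit Types P Q R : gcomplex A.

Lemma hom_comp_comp P Q R p q p' q' (f : fmap Q R) (g : fmap P Q) :
  hom_comp p q f -> hom_comp p' q' g ->
  hom_comp (p + p') (q + q') (f \o g : fmap P R).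
Proof.
move=> [fL fd] [gL gd]; split=> [a x y|n i x xC] /=; first by rewrite gL fL.
rewrite (_ : n - (p + p') = n - p' - p); last by ring.
rewrite (_ : i + (q + q') = i + q' + q); last by ring.
exact/fd/gd.
Qed.

Lemma hom_compD P Q p q (f g : fmap P Q) : hom_comp p q f -> hom_comp p q g ->
  hom_comp p q (fun x => f x + g x).
Proof.
move=> [fL fd] [gL gd]; split=> [a x y|n i x xC].
  by rewrite fL gL scalerDr addrACA.
by apply: (gradingD (cx_grading Q) (i := (n - p, i + q))); [apply: fd|apply: gd].
Qed.

Lemma hom_compB P Q p q (f g : fmap P Q) : hom_comp p q f -> hom_comp p q g ->
  hom_comp p q (fun x => f x - g x).
Proof.
move=> [fL fd] [gL gd]; split=> [a x y|n i x xC].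
  by rewrite fL gL scalerBr opprD addrACA.
by apply: (gradingB (cx_grading Q) (i := (n - p, i + q))); [apply: fd|apply: gd].
Qed.

Lemma hom_comp0 P Q p q : hom_comp p q ((fun _ => 0) : fmap P Q).
Proof.
split=> [a x y|n i x xC]; first by rewrite scaler0 addr0.
exact: (grading0 (cx_grading Q) (n - p, i + q)).
Qed.

Lemma hom_comp_d P : hom_comp 1 0 (cx_d P : fmap P P).
Proof.
by split=> [a x y|n i x xC]; [rewrite linearP|rewrite addr0; apply: cx_d_deg].
Qed.

Lemma hom_comp_id P : hom_comp 0 0 (id : fmap P P).
Proof. by split=> // n i x; rewrite subr0 addr0. Qed.

End HomComp.

(** * Comparison of resolutions and vanishing of Ext *)

Section Comparison.
Variables (F : fieldType) (A : galgebra F).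
Implicit Types P Q : resolution A.

Lemma res_neg P n i (x : P) : n < 0 -> cx_comp P n i x -> x = 0.
Proof. by move=> n0 /cx_obj_comp; apply: res_nonneg. Qed.

Lemma res_cycle_bound P n i (x : P) : cx_comp P n i x -> cx_d P x = 0 ->
  (n = 0 -> res_aug P x = 0) -> exists y, cx_d P y = x.
Proof.
move=> xC dx aug0; have [n0|n0|n0] := ltrgtP n 0.
- by exists 0; rewrite linear0 (res_neg n0 xC).
- exact: (res_exact n0 (cx_obj_comp xC) dx).
- rewrite n0 in xC.
  by have [/(_ (aug0 n0))] := res_exact0 (cx_obj_comp xC).
Qed.

(** The chain map is built degree by degree and stopped below [N]; a finite stage suffices because
    each use concerns a fixed homological degree. *)
Lemma comparison_map P Q (N : nat) : exists f : fmap P Q, [/\ hom_comp 0 0 f,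
  forall k i x, k < N%:Z -> cx_comp P k i x -> cx_d Q (f x) = f (cx_d P x),
  forall k i x, N%:Z <= k -> cx_comp P k i x -> f x = 0 &
  forall i x, (0 < N)%N -> cx_comp P 0 i x -> res_aug Q (f x) = res_aug P x].
Proof.
elim: N => [|N [f [fH fd f0 fa]]].
  exists (fun _ => 0); split=> // [|k i x _ _]; first exact: hom_comp0.
  by rewrite linear0.
have [fL fC] := fH.
(* The correction [g] lives in degree [N] alone, so adding it leaves the lower degrees untouched. *)
suff [g [gH gd g0 ga]] : exists g : fmap P Q, [/\ hom_comp 0 0 g,
    forall i x, cx_comp P N i x -> cx_d Q (g x) = f (cx_d P x),
    forall k i x, k != N%:Z -> cx_comp P k i x -> g x = 0 &
    forall i x, (N = 0)%N -> cx_comp P N i x -> res_aug Q (g x) = res_aug P x].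
  exists (fun x => f x + g x); split=> [|k i x|k i x Nk xC|i x _ xC].
  - exact: hom_compD.
  - rewrite linearD => kN xC.
    rewrite (g0 _ _ _ _ (cx_d_deg xC)) ?addr0; last by lia.
    have [kN'|kN'] := eqVneq k N.
      by rewrite kN' in xC *; rewrite (gd _ _ xC) (f0 _ _ _ _ xC) // linear0 add0r.
    by rewrite (g0 _ _ _ kN' xC) linear0 addr0 (fd _ _ _ _ xC) //; lia.
  - by rewrite (f0 _ _ _ _ xC) ?(g0 _ _ _ _ xC) ?addr0 //; lia.
  - case: (posnP N) => [N0|N0].
      by rewrite (f0 _ _ _ _ xC) ?N0 // add0r (ga i) // N0.
    by rewrite (g0 _ _ _ _ xC) ?addr0 ?(fa i) //; lia.
case: (posnP N) => [N0|N0].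
- have [|g [gH ga g0]] := graded_free_lift (n := N%:Z) (res_free P N)
    (res_aug_deg P) (res_aug_deg Q).
    by move=> i x _; have [y <-] := res_aug_surj Q (res_aug P x); exists y.
  rewrite subr0 in gH; exists g; split=> // [i x xC|i x _]; last exact: ga.
  rewrite (res_neg _ (cx_d_deg xC)) ?(linear_fun0 fL); last by lia.
  have [_ /(_ _ _ _ xC) gC] := gH.
  by rewrite (res_neg _ (cx_d_deg gC)) //; lia.
- have [|g [gH gd g0]] := graded_free_lift (n := N%:Z) (res_free P N)
    (hom_comp_comp fH (hom_comp_d P)) (hom_comp_d Q).
    move=> i x xC /=; have dC := cx_d_deg xC; apply: (res_cycle_bound (fC _ _ _ dC)).
      by rewrite (fd _ _ _ _ dC) ?cx_dd ?(linear_fun0 fL) //; lia.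
    (* For [N = 1] the cycle lies in degree 0, where it must also be killed by the augmentation. *)
    rewrite subr0 => N1; rewrite N1 in dC; rewrite (fa _ _ _ dC) //.
    by apply/(res_exact0 (cx_obj_comp dC)); exists x.
  rewrite add0r subrr in gH; exists g; split=> // i x E; lia.
Qed.

(** In degree [N] the map [f - h d] takes values in cycles, since [f d = d h d] by the homotopy
    already built below. These cycles are boundaries, and lifting through [d] gives the next
    component of [h]. *)
Lemma comparison_homotopy P Q (N : nat) (f : fmap P Q) : hom_comp 0 0 f ->
  (forall k i x, k < N%:Z -> cx_comp P k i x -> cx_d Q (f x) = f (cx_d P x)) ->
  (forall i x, cx_comp P 0 i x -> (0 < N)%N -> res_aug Q (f x) = 0) ->
  exists h : fmap P Q, [/\ hom_comp (-1) 0 h,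
    forall k i x, k < N%:Z -> cx_comp P k i x ->
      f x = cx_d Q (h x) + h (cx_d P x) &
    forall k i x, N%:Z <= k -> cx_comp P k i x -> h x = 0].
Proof.
move=> fH; have [fL fC] := fH; elim: N => [|N IHN] fd fa.
  exists (fun _ => 0); split=> //; first exact: hom_comp0.
  by move=> k i x k0 xC; rewrite (res_neg _ xC) // !linear0 (linear_fun0 fL) addr0.
have [|i x xC _|h [hH hd h0]] := IHN.
- by move=> k i x kN; apply: fd; lia.
- exact: fa xC _.
have [hL hC] := hH.
have hdH : hom_comp 0 0 (h \o cx_d P : fmap P Q).
  by have := hom_comp_comp hH (hom_comp_d P); rewrite addr0 addNr.
have gH := hom_compB fH hdH.
have [|g [gH' gd g0]] := graded_free_lift (n := N%:Z)
    (res_free P N) gH (hom_comp_d Q).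
  move=> i x xC; have dC := cx_d_deg xC; have [_ gC] := gH.
  apply: (res_cycle_bound (gC _ _ _ xC)) => [|N0].
    rewrite linearB /= (fd _ _ _ _ xC); last by lia.
    by rewrite (hd _ _ _ _ dC) ?cx_dd ?(linear_fun0 hL) ?addr0 ?subrr //; lia.
  rewrite linearB /= (res_neg _ dC) ?(linear_fun0 hL) ?linear0 ?oppr0 ?addr0; last by lia.
  by rewrite subr0 in N0; rewrite N0 in xC; rewrite ?addr0 ?(fa i).
rewrite sub0r in gH'.
exists (fun x => h x + g x); split=> [|k i x kN xC|k i x Nk xC].
- exact: hom_compD.
- rewrite linearD (g0 _ _ _ _ (cx_d_deg xC)) ?addr0; last by lia.
  have [kN'|kN'] := eqVneq k N.
    rewrite kN' in xC; rewrite (gd _ _ xC) (h0 _ _ _ _ xC) // linear0 add0r /=.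
    by rewrite subrK.
  by rewrite (g0 _ _ _ kN' xC) linear0 addr0 (hd _ _ _ _ xC) //; lia.
- by rewrite (h0 _ _ _ _ xC) ?(g0 _ _ _ _ xC) ?addr0 //; lia.
Qed.

Lemma cls_eq0 P (p q : int) (f : fmap P (triv_cx A)) :
  cocycle_comp p q f -> coboundary_comp p q f -> cls f = 0.
Proof.
move=> fZ fB.
have zP : (0 : fmap P (triv_cx A)) \in @cocycle F A P (triv_cx A) by apply: rpred0.
have -> : 0 = cls (0 : fmap P (triv_cx A)).
  rewrite /cls (_ : insubd _ _ = 0) /coh_pi ?raddf0 //.
  by apply: val_inj; rewrite /= insubdK.
apply/cls_eq => //; last rewrite subr0.
  by apply/asboolP/(sum_of1 (i := (p, q))).
by apply/asboolP/(sum_of1 (i := (p, q))).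
Qed.

(** A cochain of degree [p] with values in the trivial module is supported in homological degree
    [p], where [P] is zero. *)
Lemma Ext_comp_neg P p j (x : Ext P) : p < 0 -> Ext_comp P p j x -> x = 0.
Proof.
move=> p0 [f [[fL fC] fd] ->]; apply: (cls_eq0 (p := p) (q := - j)) => //.
have -> : f = 0.
  apply/funext => y; have [t tC ->] := grading_decomp (cx_grading P) y.
  rewrite (linear_fun_sum fL) big_seq big1 // => k /tC kC.
  case: (fC _ _ _ kC) => // -[k0 _]; rewrite (res_neg _ kC) ?(linear_fun0 fL) //.
  by lia.
exists (fun _ => 0); first exact: hom_comp0.
by apply/funext => y; rewrite /hom_d /=; rewrite !fctE /= scaler0 subr0.
Qed.

Lemma Ext_comp_generated P Q (n : nat) (D : set int) j (x : Ext P) :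
  generated_in Q n D -> ~ D j -> Ext_comp P n j x -> x = 0.
Proof.
move=> QD Dj [f [fH fd] ->]; have [fL fC] := fH.
(* Stage [n.+1] covers degree [n], the only one where [f] can be nonzero. *)
have [u [uH ud _ ua]] := comparison_map P Q n.+1.
have [v [vH vd _ va]] := comparison_map Q P n.+1.
have vuH := hom_comp_comp vH uH.
have [|||h [hH hd _]] := @comparison_homotopy P P n.+1 (fun x => x - v (u x)).
- exact: hom_compB (hom_comp_id _) vuH.
- move=> k i y kn yC; have [_ /(_ _ _ _ yC) uC] := uH.
  rewrite subr0 addr0 in uC; rewrite linearB /= (vd _ _ _ _ uC) //.
  by rewrite (ud _ _ _ _ yC).
- move=> i y yC _; have [_ /(_ _ _ _ yC) uC] := uH.
  rewrite subr0 addr0 in uC.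
  by rewrite linearB /= (va _ _ _ uC) // (ua _ _ _ yC) // subrr.
have [hL hC] := hH.
(* The trivial complex has zero differential, so the cocycle condition says [f d = 0] up to sign. *)
have fd0 y : f (cx_d P y) = 0.
  move: fd; rewrite /hom_d (_ : _ \o f = 0) ?sub0r; last exact/funext.
  move=> /eqP; rewrite oppr_eq0 scaler_eq0 expfz_eq0 oppr_eq0 oner_eq0 andbF => /eqP.
  by move/(congr1 (fun g : fmap P (triv_cx A) => g y)).
have fhH : hom_comp (n%:Z - 1) (- j) (f \o h : fmap P (triv_cx A)).
  by have := hom_comp_comp fH hH; rewrite addr0.
have fE y : f y = f (h (cx_d P y)).
  have [t tC ->] := grading_decomp (cx_grading P) y.
  rewrite !linear_sum (linear_fun_sum hL) !(linear_fun_sum fL).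
  rewrite big_seq [RHS]big_seq; apply: eq_bigr => k /tC.
  case: k => -[k i] {}y /= yC; have [kn|kn] := eqVneq k n%:Z; last first.
    have f0 z : cx_comp P k i z -> f z = 0.
      by move=> zC; case: (fC _ _ _ zC) => // -[]; lia.
    rewrite !f0 //; have := hC _ _ _ (cx_d_deg yC).
    by rewrite opprK subrK addr0.
  rewrite {k}kn in yC.
  have -> : f y = f (cx_d P (h y) + h (cx_d P y) + v (u y)).
    by rewrite -(hd _ _ _ _ yC) ?subrK //; lia.
  rewrite !(linear_funD fL) fd0 add0r.
  (* The remaining term [f (v (u y))] vanishes: [u y] is a combination of generators of degrees [l]
     in [D], and [f \o v] sends these to internal degree [l - j], which is nonzero. *)
  have [_ /(_ _ _ _ yC)] := uH; rewrite subr0 addr0 => /cx_obj_comp /QD [s sD ->].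
  have [vL vC] := vH.
  rewrite (linear_fun_sum vL) (linear_fun_sum fL) big_seq big1 ?addr0 // => k /sD[l Dl kC].
  rewrite (linear_funZ vL) (linear_funZ fL).
  have := fC _ _ _ (vC _ _ _ kC); rewrite subr0 addr0 => -[->|[_ lj]].
    by rewrite scaler0.
  by case: Dj; rewrite -(_ : l = j) //; lia.
apply: (cls_eq0 (p := n) (q := - j)) => //.
pose e : F := (-1) ^ (n%:Z - 1).
have eU : e != 0 by rewrite expfz_eq0 oppr_eq0 oner_eq0 andbF.
(* [hom_d] of [f \o h] is [- e] times [f \o h \o d]; the scalar cancels this sign. *)
exists (- e^-1 *: (f \o h : fmap P (triv_cx A))); first exact: hom_comp_scale.
rewrite hom_d_scale /hom_d (_ : _ \o (f \o h) = 0); last exact/funext.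
rewrite sub0r scalerN scaleNr opprK scalerA mulVf // scale1r.
exact/funext.
Qed.

End Comparison.

(** * Reduction of multilinear maps to homogeneous arguments *)

Section Multilinear.
Variables (F : fieldType) (E V : lmodType F) (g : seq E -> V).
Hypothesis gM : multilinear g.

Lemma multilinear0 s1 s2 : g (s1 ++ 0 :: s2) = 0.
Proof. by have := gM s1 s2 (-1) 0 0; rewrite scaler0 addr0 scaleN1r addNr. Qed.

Lemma multilinear_span (T : Type) (I : Type) (C : T -> I -> set E) (S : set V) w x :
  S 0 -> (forall u v, S u -> S v -> S (u + v)) ->
  (forall y, List.Forall2 (fun p z => exists i, C p i z) w y -> S (g y)) ->
  List.Forall2 (fun p => sum_of (C p)) w x -> S (g x).
Proof.
move=> S0 SD; rewrite -[x]cat0s.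
(* The induction carries a prefix [y1] of entries already made homogeneous; the next entry is then
   expanded summand by summand. *)
suff H w1 y1 : List.Forall2 (fun p z => exists i, C p i z) w1 y1 ->
    (forall y, List.Forall2 (fun p z => exists i, C p i z) (w1 ++ w) y -> S (g y)) ->
    List.Forall2 (fun p => sum_of (C p)) w x -> S (g (y1 ++ x)).
  exact: (H [::]).
move=> wy Sg wx; elim: wx w1 y1 wy Sg => {w x} [|p x w t [s sC ->] _ IH] w1 y1 wy Sg.
  by apply: Sg; apply: List.Forall2_app.
elim: s sC => [|z s IHs] sC; first by rewrite big_nil multilinear0.
rewrite big_cons -[z]scale1r gM scale1r; apply: SD; last first.
  by apply: IHs => v vs; apply: sC; rewrite in_cons vs orbT.
rewrite -cat_rcons; apply: (IH (rcons w1 p)); last by rewrite cat_rcons.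
rewrite -!cats1; apply: List.Forall2_app => //; constructor; last by constructor.
by apply: sC; rewrite mem_head.
Qed.

End Multilinear.

(** * Bidegrees of the pieces, with period 3 in cohomological and 2d in internal degree *)

Definition piece_res (p : piece) : nat :=
  match p with E0 => 0 | E1 => 1 | _ => 2 end.

Definition piece_off (d : nat) (p : piece) : nat :=
  match p with E0 => 0 | E1 => 1 | E2 | E2d => d | E2d1 => d + 1 end.

(* The internal degree of the non-basic piece [E2] is left free. *)
Definition piece_deg (d : nat) (p : piece) (k : int * int) : Prop :=
  exists n : nat, k.1 = (3 * n + piece_res p)%N%:Z /\
    (basic p -> k.2 = (2 * d * n + piece_off d p)%N%:Z).

Section Pieces.
Variables (F : fieldType) (A : galgebra F) (d : nat) (hA : bi_Koszul A d).
Variable (P : resolution A).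

(** [Delta] read backwards: the residue of [n] modulo 3 gives the piece, and in residue 2 the
    internal degree separates the two halves. *)
Lemma Ext_comp_piece p j (x : Ext P) : Ext_comp P p j x ->
  x = 0 \/ exists2 q, basic q & piece_deg d q (p, j).
Proof.
case: p => n xC; last by left; apply: Ext_comp_neg xC.
have [Q [_ QD]] := hA.
have [jD|jD] := pselect (j = (Delta d n).1%:Z \/ j = (Delta d n).2%:Z); last first.
  by left; apply: Ext_comp_generated (QD n) jD xC.
right; have := ltn_pmod n (isT : 0 < 3)%N; have := divn_eq n 3.
move: jD; rewrite /Delta; case: (n %% 3)%N => [|[|[|//]]] /= jD nE _.
- by exists E0 => //; exists (n %/ 3)%N; rewrite /=; lia.
- by exists E1 => //; exists (n %/ 3)%N; rewrite /=; lia.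
- case: jD => ->; [exists E2d|exists E2d1] => //; exists (n %/ 3)%N; rewrite /=; lia.
Qed.

Let deg_comp p (k : int * int) : set (Ext P) :=
  [set x | piece_deg d p k /\ Ext_comp P k.1 k.2 x].

Lemma Ext_deg_span p (n : nat) (x : Ext P) :
  (forall j q, basic q -> piece_deg d q ((3 * n + piece_res p)%N%:Z, j) ->
     piece_deg d p ((3 * n + piece_res p)%N%:Z, j)) ->
  Ext_deg P (3 * n + piece_res p)%N%:Z x -> sum_of (deg_comp p) x.
Proof.
move=> pq; apply: sum_of_bind => j z zC.
have [->|[q qb /pq qd]] := Ext_comp_piece zC; first exact: sum_of0.
by apply: (@sum_of1 _ _ _ ((3 * n + piece_res p)%N%:Z, j)); split=> //; apply: qd.
Qed.

(** [E0] and [E1] are defined by cohomological degree alone; that their internal degree is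
    determined too comes from the bi-Koszul hypothesis. *)
Lemma piece_set_span p (x : Ext P) : piece_set P d p x -> sum_of (deg_comp p) x.
Proof.
have inj (q q' : piece) (n n' : nat) :
    (3 * n + piece_res q)%N%:Z = (3 * n' + piece_res q')%N%:Z ->
    n = n' /\ piece_res q = piece_res q'.
  by case: q; case: q' => /=; lia.
case: p; apply: sum_of_bind => n y; rewrite ?[(3 * n)%N]addn0.
- move=> yC; apply: (@Ext_deg_span E0 n); rewrite /= addn0 // => j q qb [n' [/= e ->]] //.
  exists n; rewrite /= !addn0; split=> // _.
  have := inj E0 q n n'; rewrite /= addn0 => /(_ e)[-> ].
  by case: q qb {e} => //=; rewrite addn0.
- move=> yC; apply: (@Ext_deg_span E1 n) => // j q qb [n' [/= e ->]] //.
  exists n; split=> // _.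
  by have [-> ] := inj E1 q n n' e; case: q qb {e}.
- by move=> yC; apply: (@Ext_deg_span E2 n) => // j q qb _; exists n.
- by move=> yC; apply: (@sum_of1 _ _ _ (_, _) _ (conj _ yC)); exists n.
- by move=> yC; apply: (@sum_of1 _ _ _ (_, _) _ (conj _ yC)); exists n; rewrite /= addnA.
Qed.

Lemma piece_set_Ext_comp r (n : nat) j (x : Ext P) : r \in [:: E0; E1; E2] ->
  Ext_comp P (3 * n + piece_res r)%N%:Z j x -> piece_set P d r x.
Proof.
move=> rE xC; have xD := sum_of1 (C := fun j => Ext_comp P (3 * n + piece_res r)%N%:Z j) xC.
case: r rE {xC} xD => // _ /= xD; apply: (sum_of1 (i := n)) => //=.
by rewrite addn0 in xD.
Qed.

(** [K] is the total number of periods [(3, 2d)] contributed by the entries. *)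
Lemma Forall2_degrees w (y : seq (Ext P)) :
  List.Forall2 (fun p z => exists k, deg_comp p k z) w y ->
  exists (ks : seq (int * int)) (K : nat),
  [/\ List.Forall2 (fun k z => Ext_comp P k.1 k.2 z) ks y, size y = size w,
    \sum_(k <- ks) k.1 = (3 * K + sumn (map piece_res w))%N%:Z &
    all basic w ->
      \sum_(k <- ks) k.2 = (2 * d * K + sumn (map (piece_off d) w))%N%:Z].
Proof.
elim: {w y} _ / => [|p z w y [k [[n [k1 k2]] kC]] _ [ks [K [kyC yw K1 K2]]]].
  by exists [::], 0%N; split=> //= *; rewrite ?big_nil //; lia.
exists (k :: ks), (n + K)%N; split=> /=; rewrite ?yw //; first by constructor.
  by rewrite big_cons K1 k1; lia.
by move=> /andP[/k2 {}k2 /K2 {}K2]; rewrite big_cons K2 k2; lia.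
Qed.

End Pieces.

(** * Combinatorics of the words in the table *)

Lemma perm_piece (w v : seq piece) :
  (forall p, count_mem p w = count_mem p v) -> perm_eq w v.
Proof. by move=> wv; apply/allP => p _; rewrite /= wv. Qed.

(** The index permutation turning [v] into [w] is applied to [v'] as well, which keeps entries
    matched. *)
Lemma listed_perm d w v v' r : perm_eq w v -> all2 sub_piece v v' ->
  (v', r) \in mult_table d -> listed d w.
Proof.
rewrite all2E => wv /andP[/eqP vv' /(all_nthP (E0, E0)) sub] v'r; exists v', r; split=> //.
have /(perm_iotaP E0)[Is IsE ->] := wv.
exists (map (nth E0 v') Is); first by apply/(perm_iotaP E0); exists Is; rewrite -?vv'.
have {wv IsE} : all (ltn^~ (size v)) Is.
  by apply/allP => i; rewrite (perm_mem IsE) mem_iota.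
elim: Is => //= i Is IHIs /andP[iv /IHIs ->]; rewrite andbT.
by have := sub i; rewrite size_zip -vv' minnn nth_zip //; apply.
Qed.

(** A value piece in the table depends on cohomological degree only, so this congruence, reflecting
    the degree [2 - n] of [m_n], is what the first claim needs. *)
Lemma table_res d w r : (2 <= d)%N -> (w, r) \in mult_table d ->
  [/\ (0 < size w)%N, r \in [:: E0; E1; E2] &
      sumn (map piece_res w) + 2 = size w + piece_res r %[mod 3]]%N.
Proof.
move=> hd; rewrite /mult_table !inE.
do 13 ! (case/orP=> [/eqP[-> ->]|]; first by split=> //;
  rewrite ?map_rcons ?map_nseq ?sumn_rcons ?sumn_nseq ?size_rcons ?size_nseq //=; lia).
move=> /eqP[-> ->]; split=> //=. by rewrite ?map_nseq ?sumn_nseq ?size_nseq /=; lia.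
Qed.

Lemma basic_counts d w (n := fun p => count_mem p w) : all basic w ->
  [/\ size w = n E0 + n E1 + n E2d + n E2d1, n E2 = 0,
      sumn (map piece_res w) = n E1 + 2 * (n E2d + n E2d1) &
      sumn (map (piece_off d) w) = n E1 + d * n E2d + (d + 1) * n E2d1]%N.
Proof.
rewrite {}/n; elim: w => [|p w IHw] /=; first by split; lia.
by move=> /andP[pb /IHw[-> -> -> ->]]; case: p pb => //= _; split; lia.
Qed.

(* Here [a] counts the entries in E^[0], [u] those in E^[2], and [v] those in
   E^[1] or E^[2]_(d+1); [q] is the piece of the value. *)
Lemma piece_arith (d a u v K n : nat) (q : piece) : (2 <= d)%N -> basic q ->
  (3 * K + 2 + u = 3 * n + piece_res q + a)%N ->
  (2 * d * K + v + d * u = 2 * d * n + piece_off d q)%N ->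
  ((u = 0 /\ v = 0 /\ a = 2) \/ (u = 2 /\ v = 0 /\ a = 1) \/
   (u = 4 /\ v = 0 /\ a = 0) \/ (u = 1 /\ v = d /\ a = 0) \/
   (u = 0 /\ v = 1 /\ a = 1) \/ (u = 2 /\ v = 1 /\ a = 0) \/
   (u = 1 /\ v <= 1 /\ a = 1) \/ (u = 3 /\ v <= 1 /\ a = 0) \/
   (u = 0 /\ d <= v <= d.+1 /\ a = 0))%N.
Proof.
move=> hd qb E1 E2.
(* Internal degrees force [v] to be a multiple of [d] up to an offset 0 or 1,
   and cohomological degrees bound the multiple [t] by 1. *)
have [l [o [lE o1 offE]]] : exists l o, [/\ piece_res q = 2 * l + (1 - l) * o,
    l <= 1 /\ o <= 1 & piece_off d q = l * d + o]%N.
  by case: q qb {E1 E2} => //= _; [exists 0, 0|exists 0, 1|exists 1, 0|exists 1, 1];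
    split; lia.
rewrite {}offE {}lE {qb} in E1 E2.
(* The internal equation solved for [v] reads [v = o + d t]. *)
pose t : int := 2 * (n%:Z - K%:Z) + l%:Z - u%:Z.
have vE : v%:Z = o%:Z + d%:Z * t by rewrite /t; lia.
have t0 : 0 <= t by nia.
have [l01 o01] : (l = 0 \/ l = 1)%N /\ (o = 0 \/ o = 1)%N by lia.
(* Eliminating [n - K] between the two equations bounds [3 t + 2 a + u] by 4. *)
have tE : 3 * t = (4 - l)%:Z - 2 * (1 - l)%:Z * o%:Z - 2 * a%:Z - u%:Z.
  by rewrite /t; case: l01 o01 E1 {vE E2 t0 t} => -> [->|->]; lia.
have {E1 E2}uE : 3 * (n%:Z - K%:Z) = 2 + u%:Z - a%:Z - 2 * l%:Z - (1 - l)%:Z * o%:Z.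
  by case: l01 o01 E1 {vE E2 tE t0 t} => -> [->|->]; lia.
have t01 : t = 0 \/ t = 1 by case: l01 o01 tE => -> [->|->]; lia.
have a2 : (a = 0 \/ a = 1 \/ a = 2)%N by case: l01 o01 tE => -> [->|->]; lia.
have tK : t = 2 * (n%:Z - K%:Z) + l%:Z - u%:Z by [].
clearbody t; case: l01 o01 a2 t01 tE uE vE tK {o1 t0} =>
  -> [->|->] [->|[->|->]] [->|->] tE uE vE tK.
all: try (exfalso; lia).
all: repeat first [by left; lia | right]; lia.
Qed.

(** The number of entries [E2d1] resolves what the sums leave open; each case is then one row of the
    table, whose position is the number passed to [L]. *)
Lemma count_listed d w (n := fun p => count_mem p w) : (2 <= d)%N -> n E2 = 0%N ->
  ((n E2d + n E2d1 = 0 /\ n E1 + n E2d1 = 0 /\ n E0 = 2) \/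
   (n E2d + n E2d1 = 2 /\ n E1 + n E2d1 = 0 /\ n E0 = 1) \/
   (n E2d + n E2d1 = 4 /\ n E1 + n E2d1 = 0 /\ n E0 = 0) \/
   (n E2d + n E2d1 = 1 /\ n E1 + n E2d1 = d /\ n E0 = 0) \/
   (n E2d + n E2d1 = 0 /\ n E1 + n E2d1 = 1 /\ n E0 = 1) \/
   (n E2d + n E2d1 = 2 /\ n E1 + n E2d1 = 1 /\ n E0 = 0) \/
   (n E2d + n E2d1 = 1 /\ n E1 + n E2d1 <= 1 /\ n E0 = 1) \/
   (n E2d + n E2d1 = 3 /\ n E1 + n E2d1 <= 1 /\ n E0 = 0) \/
   (n E2d + n E2d1 = 0 /\ d <= n E1 + n E2d1 <= d.+1 /\ n E0 = 0))%N ->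
  listed d w.
Proof.
move=> hd n2.
have L v i : (i < 14)%N -> all2 sub_piece v (nth ([::], E0) (mult_table d) i).1 ->
    (n E0 = count_mem E0 v -> n E1 = count_mem E1 v -> n E2d = count_mem E2d v ->
     n E2d1 = count_mem E2d1 v -> count_mem E2 v = 0 -> listed d w)%N.
  move=> i14 vE n0 n1 n3 n4 v2.
  apply: (@listed_perm d w v _ (nth ([::], E0) (mult_table d) i).2 _ vE).
    by apply/perm_piece => -[] //; rewrite v2.
  by rewrite -surjective_pairing mem_nth.
have sub_refl v : all2 sub_piece v v.
  by elim: v => //= p v ->; rewrite /sub_piece eqxx.
have cnt p q v : count_mem p (nseq q E1 ++ v) = ((E1 == p) * q + count_mem p v)%N.
  by rewrite count_cat count_nseq.
case=> [H|]; first by apply: (L [:: E0; E0] 0) => //=; lia.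
case=> [H|]; first by apply: (L [:: E0; E2d; E2d] 4) => //=; lia.
case=> [H|]; first by apply: (L [:: E2d; E2d; E2d; E2d] 8) => //=; lia.
case=> [H|].
  have [n4|n4] : (n E2d1 = 1 \/ n E2d1 = 0)%N by lia.
    by apply: (L _ 10 isT (sub_refl _)); rewrite /= -cats1 cnt /=; lia.
  by apply: (L _ 12 isT (sub_refl _)); rewrite /= -cats1 cnt /=; lia.
case=> [H|]; first by apply: (L [:: E0; E1] 1) => //=; lia.
case=> [H|].
  have [n4|n4] : (n E2d1 = 1 \/ n E2d1 = 0)%N by lia.
    by apply: (L [:: E2d; E2d1] 2) => //=; lia.
  by apply: (L [:: E1; E2d; E2d] 5) => //=; lia.
case=> [H|].
  have [n4|[n1|n1]] : (n E2d1 = 1 \/ n E1 + n E2d1 = 0 \/ n E1 = 1 /\ n E2d1 = 0)%N by lia.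
  - by apply: (L [:: E0; E2d1] 3) => //=; lia.
  - by apply: (L [:: E0; E2d] 3) => //=; lia.
  - by apply: (L [:: E0; E1; E2d] 6) => //=; lia.
case=> [H|H].
  have [n4|[n1|n1]] : (n E2d1 = 1 \/ n E1 + n E2d1 = 0 \/ n E1 = 1 /\ n E2d1 = 0)%N by lia.
  - by apply: (L [:: E2d1; E2d; E2d] 7) => //=; lia.
  - by apply: (L [:: E2d; E2d; E2d] 7) => //=; lia.
  - by apply: (L [:: E1; E2d; E2d; E2d] 9) => //=; lia.
have [n1|n1] : (n E1 = d \/ n E1 = d.+1)%N by lia.
  by apply: (L _ 11 isT (sub_refl _)); rewrite /= -[nseq _ _]cats0 cnt /=; lia.
by apply: (L _ 13 isT (sub_refl _)); rewrite /nth /= -[nseq _ _]cats0 cnt /=; lia.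
Qed.

(* The multiplications on the pieces *)
Local Close Scope ring_scope.
Local Close Scope classical_set_scope.

Theorem proposition2p5 (F : fieldType) (d : nat) (hd : (2 <= d)%N)
  (A : galgebra F) (hA : bi_Koszul A d)
  (P : resolution A) (m : seq (Ext P) -> Ext P) (hm : Ainf_Ext_structure m) :
  (forall (w : seq piece) (r : piece), (w, r) \in mult_table d ->
     forall w' : seq piece, perm_eq w' w ->
     forall x : seq (Ext P), List.Forall2 (piece_set P d) w' x ->
       piece_set P d r (m x)) /\
  (forall w : seq piece, size w \in [:: 2; 3; 4; d; d.+1] -> all basic w ->
     ~ listed d w ->
     forall x : seq (Ext P), List.Forall2 (piece_set P d) w x -> m x = 0%R).
Proof.
have [[mM _ _ _] _ _ mdeg _] := hm.
have span w x : List.Forall2 (piece_set P d) w x ->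
    List.Forall2 (fun p => sum_of (fun k =>
      [set z | piece_deg d p k /\ Ext_comp P k.1 k.2 z]%classic)) w x.
  by apply: List.Forall2_impl => p z; apply: piece_set_span.
split=> [w r wr w' ww' x /span|w wn wb wl x /span].
- have [w0 rE res] := table_res hd wr.
  have piece0 q : piece_set P d q 0%R by case: q; apply: sum_of0.
  have pieceD q u v : piece_set P d q u -> piece_set P d q v -> piece_set P d q (u + v)%R.
    by case: q; apply: sum_ofD.
  apply: (multilinear_span mM) => [||y /Forall2_degrees[ks [K [ksy yw K1 _]]]] //.
    exact: pieceD.
  have y0 : (0 < size y)%N by rewrite yw (perm_size ww').
  have := mdeg _ _ y0 ksy; rewrite K1 yw (perm_size ww') (perm_sumn (perm_map _ ww')).
  (* The degree of the value may be negative, and then the value is zero. *)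
  set p := (_ + 2 - _)%R; have [p0 /(Ext_comp_neg p0) -> //|p0] := ltP p 0%R.
  rewrite (_ : p = (3 * (`|p| %/ 3) + piece_res r)%N%:Z%R).
    exact: piece_set_Ext_comp.
  by move: p0; rewrite /p; case: (r) res => /= res p0; lia.
- apply: (multilinear_span mM (S := [set z | z = 0%R]%classic)) => //.
    by move=> _ _ -> ->; rewrite addr0.
  move=> y /Forall2_degrees[ks [K [ksy yw K1 K2]]].
  have y0 : (0 < size y)%N.
    by rewrite yw; move: wn; rewrite !inE; case: (size w) => //; lia.
  (* A value not known to be zero has the bidegree of a basic piece [q]; its two degrees give the
     equations that force [w] into the table. *)
  have /(Ext_comp_piece hA)[//|[q qb [n [/= n1 /(_ qb) n2]]]] := mdeg _ _ y0 ksy.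
  have [wsz wE2 wres woff] := basic_counts d wb.
  case: wl; apply: count_listed => //.
  rewrite K1 wres yw wsz in n1; rewrite (K2 wb) woff in n2.
  by apply: (@piece_arith d _ _ _ K n q); lia.
Qed.
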